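(* The Farey graph $F$ is a tightly typical $\Pi$-graph, and every tightly typical $\Pi$-graph is tightly minor-equivalent to $F$. In other words, up to tight minor-equivalence, the Farey graph is the unique tightly typical $\Pi$-graph.
   Context: Graphs are simple and may be infinite. The Farey graph $F$ is the graph with vertex set $\mathbb{Q}\cup\{\infty\}$ in which two rationals $a/b$ and $c/d$ written in lowest terms (allowing $\infty=(\pm1)/0$) are adjacent if and only if $ad-bc=\pm1$. A graph is infinitely edge-connected if it has at least two vertices and $G-E'$ is connected for every finite set $E'$ of edges. Paths are independent if they are internally vertex-disjoint. A $\Pi$-graph is an infinitely edge-connected graph that does not contain infinitely many independent paths between any two of its vertices. A graph $H$ is a minor of $G$ if there are pairwise disjoint non-empty vertex sets $V_h\subseteq V(G)$ ($h\in V(H)$), each inducing a connected subgraph of $G$ (the branch sets), such that for every edge $hh'$ of $H$ there is an edge of $G$ between $V_h$ and $V_{h'}$. A tight minor is a minor all of whose branch sets are finite. Two graphs are tightly minor-equivalent if each is a tight minor of the other. A $\Pi$-graph is tightly typical if it occurs as a tight minor in every $\Pi$-graph. *)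

(* Defs.v *)
From mathcomp Require Import all_boot all_order all_algebra.
From Stdlib Require Import List Relations.
Import Order.TTheory GRing.Theory Num.Theory.

Set Implicit Arguments. Unset Strict Implicit. Unset Printing Implicit Defensive.

Record graph := Graph {
  vertex : Type;
  adj : vertex -> vertex -> Prop;
  adj_sym : forall x y, adj x y -> adj y x;
  adj_irrefl : forall x, ~ adj x x
}.

(* Vertex set Q ∪ {∞}: [Some q] is the rational q, [None] is ∞ = 1/0.
   A rational q is written in lowest terms as numq q / denq q. *)
Definition farey_adj (x y : option rat) : Prop :=
  match x, y with
  | Some p, Some q =>
      `|numq p * denq q - denq p * numq q|%R = 1%R
  | Some p, None => `|denq p|%R = 1%R      (* a/b ~ 1/0 iff |a*0 - b*1| = 1 *)
  | None, Some q => `|denq q|%R = 1%R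
  | None, None => False
  end.

Lemma farey_adj_sym x y : farey_adj x y -> farey_adj y x.
Proof.
case: x => [p|]; case: y => [q|] //=.
by move=> <-; rewrite -normrN opprB (mulrC (numq q)) (mulrC (denq q)).
Qed.

Lemma farey_adj_irrefl x : ~ farey_adj x x.
Proof.
case: x => [p|] //=.
by rewrite mulrC subrr normr0 => /eqP; rewrite eq_sym oner_eq0.
Qed.

Definition Farey : graph := Graph farey_adj_sym farey_adj_irrefl.

Definition connected_rel (V : Type) (R : V -> V -> Prop) : Prop :=
  forall x y : V, clos_refl_trans V R x y.

Definition adj_minus (G : graph) (E : list (vertex G * vertex G)) (x y : vertex G) :=
  adj x y /\ ~ In (x, y) E /\ ~ In (y, x) E.

Definition inf_edge_connected (G : graph) : Prop :=
  (exists x y : vertex G, x <> y) /\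
  forall E : list (vertex G * vertex G), connected_rel (adj_minus E).

Fixpoint adj_chain (G : graph) (l : list (vertex G)) : Prop :=
  match l with
  | x :: ((y :: _) as l') => adj x y /\ adj_chain l'
  | _ => True
  end.

Definition is_path (G : graph) (u v : vertex G) (p : list (vertex G)) : Prop :=
  hd_error p = Some u /\ last p u = v /\ NoDup p /\ adj_chain p.

Definition inner (G : graph) (u v : vertex G) (p : list (vertex G)) (x : vertex G) :=
  In x p /\ x <> u /\ x <> v.

Definition inf_indep_paths (G : graph) (u v : vertex G) : Prop :=
  exists f : nat -> list (vertex G),
    (forall n, is_path u v (f n)) /\
    (forall m n, m <> n -> f m <> f n) /\
    (forall m n, m <> n -> forall x, ~ (inner u v (f m) x /\ inner u v (f n) x)).

Definition Pi_graph (G : graph) : Prop :=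
  inf_edge_connected G /\ forall u v : vertex G, ~ inf_indep_paths u v.

Definition induced_connected (G : graph) (S : vertex G -> Prop) : Prop :=
  forall x y, S x -> S y ->
    clos_refl_trans (vertex G) (fun a b => adj a b /\ S a /\ S b) x y.

Definition minor_model (H G : graph) (B : vertex H -> vertex G -> Prop) : Prop :=
  (forall h h', h <> h' -> forall x, ~ (B h x /\ B h' x)) /\
  (forall h, exists x, B h x) /\
  (forall h, induced_connected (B h)) /\
  (forall h h', adj h h' -> exists x y, B h x /\ B h' y /\ adj x y).

Arguments minor_model : clear implicits.

Definition is_minor (H G : graph) : Prop := exists B, minor_model H G B.

Definition finite_set (T : Type) (S : T -> Prop) : Prop :=
  exists l : list T, forall x, S x -> In x l.

Definition tight_minor (H G : graph) : Prop :=
  exists B, minor_model H G B /\ forall h, finite_set (B h).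

Definition tight_minor_equiv (G H : graph) : Prop :=
  tight_minor G H /\ tight_minor H G.

Definition tightly_typical (G : graph) : Prop :=
  Pi_graph G /\ forall H : graph, Pi_graph H -> tight_minor G H.

(* Main.v *)
From mathcomp Require Import all_boot all_order all_algebra zify ring.
From Stdlib Require Import List Relations Classical IndefiniteDescription.
From Stdlib Require Import FunctionalExtensionality PropExtensionality.
From Stdlib Require FinFun.
Require Import Defs.
Import Order.TTheory GRing.Theory Num.Theory.

Set Implicit Arguments. Unset Strict Implicit. Unset Printing Implicit Defensive.

(* Since a tightly typical graph is a tight minor of every Pi-graph, both claims
   follow once F is a Pi-graph and a tight minor of every Pi-graph G.

   Finding F in G. Call disjoint finite connected adjacent sets U, W linked through
   a set D of unused vertices if no finite edge set meets all U-W walks with inner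
   vertices in D. As G has no infinite family of independent paths between two
   vertices, a finite S in D separates U from W in D. Cutting the walks at S, a
   finite bound on edges gives s, t in S such that U is linked to s and t to W
   through D - S, with s and t in one component of D. Any finite connected M in D
   that contains s, t and is adjacent to U and W is then linked to U and to W
   through disjoint parts of D. Repeating this yields the branch sets of the halved
   Farey graph on U, W, each of which is fixed when it is created. Contracting
   the starting edge UW glues the two halves on either side of M along one edge,
   and the result is F.

   F is infinitely edge-connected because an edge can be rerouted through
   the mediant of its ends, and iterating this reaches edges whose ends are larger
   than those of any given finite edge set. To separate u from v, use a basis in
   which u is infinite and v has slope r: the vertices of slopes ceil(r) - 1 and
   floor(r) + 1 meet every u-v path other than the edge uv. *)

(** * Walks and finite connected sets *)

(** Only inner vertices are constrained: the ends will lie in branch sets outside [D]. There is at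
    least one edge, so deleting edges can always destroy the walk. *)
Inductive via (V : Type) (R : V -> V -> Prop) (D : V -> Prop) : V -> V -> Prop :=
| via_edge a b : R a b -> via R D a b
| via_step a x b : R a x -> D x -> via R D x b -> via R D a b.

Lemma via_mono V (R R' : V -> V -> Prop) (D D' : V -> Prop) a b :
  (forall x y, R x y -> R' x y) -> (forall x, D x -> D' x) ->
  via R D a b -> via R' D' a b.
Proof.
move=> RR' DD'; elim=> {a b} [a b /RR'|a x b /RR' ax /DD' Dx _ xb].
  exact: via_edge.
exact: via_step ax Dx xb.
Qed.

Lemma via_trans V (R : V -> V -> Prop) (D : V -> Prop) a x b :
  via R D a x -> D x -> via R D x b -> via R D a b.
Proof.
elim=> {a x} [a x ax Dx|a y x ay Dy _ IH Dx xb]; first exact: via_step.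
by apply: via_step ay Dy _; apply: IH.
Qed.

Lemma via_rcons V (R : V -> V -> Prop) (D : V -> Prop) a x b :
  via R D a x -> D x -> R x b -> via R D a b.
Proof. by move=> ax Dx xb; apply: via_trans ax Dx _; apply: via_edge. Qed.

Lemma via_sym V (R : V -> V -> Prop) (D : V -> Prop) a b :
  (forall x y, R x y -> R y x) -> via R D a b -> via R D b a.
Proof.
move=> Rsym; elim=> {a b} [a b /Rsym|a x b /Rsym xa Dx _ bx].
  exact: via_edge.
exact: via_rcons bx Dx xa.
Qed.

Lemma via_truncate V (R : V -> V -> Prop) (D B : V -> Prop) a b :
  via R D a b -> B b -> exists2 b', B b' & via R (fun x => D x /\ ~ B x) a b'.
Proof.
elim=> {a b} [a b ab Bb|a x b ax Dx _ IH /IH[b' Bb' xb']].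
  by exists b => //; apply: via_edge.
case: (classic (B x)) => [Bx|nBx]; first by exists x => //; apply: via_edge.
by exists b' => //; apply: via_step ax _ xb'.
Qed.

Lemma adj_minus_sym (G : graph) E (x y : vertex G) :
  adj_minus E x y -> adj_minus E y x.
Proof. by case=> xy [nxy nyx]; split; [exact: adj_sym|]. Qed.

Lemma adj_minus_sub (G : graph) E E' (x y : vertex G) :
  incl E E' -> adj_minus E' x y -> adj_minus E x y.
Proof.
Proof.
by move=> EE' [xy [nxy nyx]]; split=> //; split; [move=> /EE'|move=> /EE'].
Qed.

Lemma adj_minus_adj (G : graph) E (x y : vertex G) : adj_minus E x y -> adj x y.
Proof. by case. Qed.

Definition linked (G : graph) (A D B : vertex G -> Prop) : Prop :=
  forall E, exists a b, [/\ A a, B b & via (adj_minus E) D a b].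

Lemma linked_sym (G : graph) (A D B : vertex G -> Prop) :
  linked A D B -> linked B D A.
Proof.
move=> lAB E; have [a [b [Aa Bb ab]]] := lAB E.
by exists b, a; split=> //; apply: via_sym ab; apply: adj_minus_sym.
Qed.

Lemma not_linked (G : graph) (A D B : vertex G -> Prop) :
  ~ linked A D B ->
  exists E, forall a b, A a -> B b -> ~ via (adj_minus E) D a b.
Proof.
move=> /not_all_ex_not[E nE]; exists E => a b Aa Bb ab.
by apply: nE; exists a, b.
Qed.

Definition reach (G : graph) (D : vertex G -> Prop) :=
  clos_refl_trans (vertex G) (fun a b => adj a b /\ D a /\ D b).

Lemma via_reach (G : graph) (D : vertex G -> Prop) a b :
  via (@adj G) D a b -> D a -> D b -> reach D a b.
Proof.
elim=> {a b} [a b ab Da Db|a x b ax Dx _ IH Da Db]; first exact: rt_step.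
by apply: rt_trans (IH Dx Db); apply: rt_step.
Qed.

Lemma reach_sym (G : graph) (D : vertex G -> Prop) a b :
  reach D a b -> reach D b a.
Proof.
elim=> {a b} [a b [ab [Da Db]]|a|a b c _ ba _ cb].
- by apply: rt_step; split; [exact: adj_sym|].
- exact: rt_refl.
- exact: rt_trans cb ba.
Qed.

Lemma reach_mono (G : graph) (D D' : vertex G -> Prop) a b :
  (forall x, D x -> D' x) -> reach D a b -> reach D' a b.
Proof.
move=> DD'; elim=> {a b} [a b [ab [Da Db]]|a|a b c _ ba _ cb].
- by apply: rt_step; do !split => //; apply: DD'.
- exact: rt_refl.
- exact: rt_trans ba cb.
Qed.

Lemma connected_union (G : graph) (A B : vertex G -> Prop) a b :
  induced_connected A -> induced_connected B -> A a -> B b ->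
  a = b \/ adj a b -> induced_connected (fun x => A x \/ B x).
Proof.
move=> cA cB Aa Bb ab.
have rab : reach (fun x => A x \/ B x) a b.
  case: ab => [->|ab]; first exact: rt_refl.
  by apply: rt_step; split=> //; split; [left|right].
have from x : A x \/ B x -> reach (fun x => A x \/ B x) a x.
  case=> [Ax|Bx]; first by apply: reach_mono (cA _ _ Aa Ax); left.
  by apply: rt_trans rab _; apply: reach_mono (cB _ _ Bb Bx); right.
by move=> x y /from /reach_sym xa /from; apply: rt_trans xa.
Qed.

Lemma connected_single (G : graph) (a : vertex G) : induced_connected (eq a).
Proof. by move=> x y <- <-; apply: rt_refl. Qed.

Lemma finite_union T (A B : T -> Prop) :
  finite_set A -> finite_set B -> finite_set (fun x => A x \/ B x).
Proof.
move=> [l lA] [m mB]; exists (l ++ m)%list => x.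
by case=> [/lA|/mB] ?; apply/in_app_iff; [left|right].
Qed.

Lemma finite_single T (a : T) : finite_set (eq a).
Proof. by exists [:: a] => x <-; left. Qed.

Lemma connected_grow (G : graph) (D M : vertex G -> Prop) a b :
  reach D a b -> finite_set M -> induced_connected M ->
  (forall x, M x -> D x) -> M a ->
  exists M', [/\ finite_set M', induced_connected M',
    forall x, M' x -> D x, forall x, M x -> M' x & M' b].
Proof.
move=> ab; elim: {ab}(clos_rt_rt1n _ _ _ _ ab) M => {a b} [a|a y b [ay [Da Dy]] _ IH] M fM cM MD Ma.
  by exists M.
have [||||M' [? ? ? sub ?]] := IH (fun x => M x \/ y = x).
- by apply: finite_union fM _; apply: finite_single.
- by apply: connected_union (cM) (@connected_single _ y) Ma erefl _; right.
- by move=> x [/MD|<-].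
- by right.
by exists M'; split=> // x Mx; apply: sub; left.
Qed.

Lemma connected_hull (G : graph) (D : vertex G -> Prop) a l :
  D a -> (forall x, In x l -> reach D a x) ->
  exists M, [/\ finite_set M, induced_connected M,
    forall x, M x -> D x, M a & forall x, In x l -> M x].
Proof.
move=> Da; elim: l => [|y l IH] rl.
  by exists (eq a); split=> //; [exact: finite_single|exact: connected_single|move=> x <-].
have [|M [fM cM MD Ma Ml]] := IH; first by move=> x xl; apply: rl; right.
have ry : reach D a y by apply: rl; left.
have [M' [fM' cM' MD' sub M'y]] := connected_grow ry fM cM MD Ma.
by exists M'; split=> // [|x [<-//|/Ml]]; apply: sub.
Qed.

Lemma finite_bound T S (P : T -> list S -> Prop) l :
  (forall x E E', incl E E' -> P x E -> P x E') ->
  (forall x, In x l -> exists E, P x E) ->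
  exists E, forall x, In x l -> P x E.
Proof.
move=> mono; elim: l => [|y l IH] ex; first by exists [::].
have [|E HE] := IH; first by move=> x xl; apply: ex; right.
have [|E' HE'] := ex y; first by left.
exists (E ++ E')%list => x [<-|/HE].
  by apply: mono HE'; apply/incl_appr/incl_refl.
by apply: mono; apply/incl_appl/incl_refl.
Qed.

(** * Finite separators *)

(** Loop erasure: if the new first vertex [x] already occurs on the path, the path is cut back to
    that occurrence. The end [w] stays out of [NoDup] because it may lie in [D]. *)
Lemma via_path (G : graph) (D : vertex G -> Prop) x w :
  via (@adj G) D x w -> D x ->
  exists l, [/\ NoDup (x :: l), forall y, In y (x :: l) -> D y
    & adj_chain (x :: (l ++ [:: w])%list)].
Proof.
elim=> {x w} [x w xw Dx|x y w xy Dy _ IH Dx].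
  exists [::]; split=> //; first by constructor=> //; constructor.
  by move=> y [<-|].
have [l [ndl lD ch]] := IH Dy.
case: (classic (In x (y :: l))) => [xl|nxl]; last first.
  exists (y :: l); split=> //; first by constructor.
  by move=> z [<-//|]; apply: lD.
have [l1 [l2 e]] := in_split _ _ xl.
have {}ch : adj_chain ((y :: l) ++ [:: w])%list by [].
rewrite e -app_assoc in ch; rewrite e in ndl lD.
exists l2; split.
- by elim: l1 ndl {e lD ch} => //= a l1 IH1 /NoDup_cons_iff[_].
- by move=> z zl; apply: lD; apply/in_app_iff; right.
elim: l1 ch {e ndl lD} => //= a l1 IH1.
by case: l1 IH1 => [|b l1] IH1 [_].
Qed.

(** If every finite [S] fails, paths can be chosen one after another, each avoiding the inner
    vertices of all earlier ones. Asking for an inner vertex [x] leaves out the edge between [u] and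
    [w], which no vertex set cuts, and makes disjoint paths distinct. *)
Lemma pair_separator (G : graph) (D : vertex G -> Prop) u w :
  ~ inf_indep_paths u w -> u <> w -> ~ D u -> ~ D w ->
  exists S, forall x, D x -> ~ In x S -> adj u x ->
    ~ via (@adj G) (fun y => D y /\ ~ In y S) x w.
Proof.
move=> noinf uw nDu nDw; apply: NNPP => nS; apply: noinf.
have ex S : exists l, [/\ l <> [::], NoDup l, forall y, In y l -> D y /\ ~ In y S
    & adj_chain (u :: (l ++ [:: w])%list)].
  apply: NNPP => nl; apply: nS; exists S => x Dx nSx ux xw; apply: nl.
  have [l [ndl lD ch]] := via_path xw (conj Dx nSx).
  by exists (x :: l); split.
have [F HF] := functional_choice _ ex.
pose S := nat_rect (fun=> list (vertex G)) [::] (fun _ S => F S ++ S)%list.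
have FS m n : m < n -> incl (F (S m)) (S n).
  elim: n => // n IH; rewrite ltnS leq_eqVlt => /orP[/eqP->|/IH mn].
    exact/incl_appl/incl_refl.
  exact: incl_appr.
have disj m n : m <> n -> forall x, In x (F (S m)) -> ~ In x (F (S n)).
  wlog mn : m n / m < n.
    move=> hw /eqP; rewrite neq_ltn => /orP[mn|nm] x xm xn.
      by apply: (hw m n mn _ x xm xn) => e; rewrite e ltnn in mn.
    by apply: (hw n m nm _ x xn xm) => e; rewrite e ltnn in nm.
  move=> _ x xm; have [_ _ FD _] := HF (S n).
  by move=> /FD[_]; apply; apply: FS mn _ xm.
have innerF n x : inner u w (u :: (F (S n) ++ [:: w])%list) x -> In x (F (S n)).
  by move=> [[<-|/in_app_iff[//|[<-|//]]] []].
exists (fun n => u :: (F (S n) ++ [:: w])%list); split; last split.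
- move=> n; have [_ nd FD ch] := HF (S n); split=> //; split.
    exact: (last_last (u :: F (S n))).
  split=> //; constructor.
    by move=> /in_app_iff[/FD[]//|[wu|//]]; apply: uw.
  apply: NoDup_app nd _ _; first by constructor=> //; constructor.
  by move=> y /FD[Dy _] [wy|//]; apply: nDw; rewrite wy.
- move=> m n mn [/app_inv_tail e]; have [ne _ _ _] := HF (S m).
  case Fm : (F (S m)) ne => [//|x l] _.
  have xm : In x (F (S m)) by rewrite Fm; left.
  by apply: (disj m n mn x xm); rewrite -e.
by move=> m n mn x [/innerF xm /innerF xn]; apply: (disj m n mn x).
Qed.

Lemma finite_separator (G : graph) (U W D : vertex G -> Prop) :
  (forall u v : vertex G, ~ inf_indep_paths u v) ->
  finite_set U -> finite_set W ->
  (forall x, ~ (U x /\ W x)) -> (forall x, ~ (U x /\ D x)) ->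
  (forall x, ~ (W x /\ D x)) ->
  exists S, forall u x w, U u -> W w -> D x -> ~ In x S -> adj u x ->
    ~ via (@adj G) (fun y => D y /\ ~ In y S) x w.
Proof.
move=> noinf [lU fU] [lW fW] UW UD WD.
pose P (p : vertex G * vertex G) S := U p.1 -> W p.2 -> forall x,
  D x -> ~ In x S -> adj p.1 x ->
  ~ via (@adj G) (fun y => D y /\ ~ In y S) x p.2.
have [|[u w] _|S HS] := @finite_bound _ _ P (list_prod lU lW).
- move=> [u w] E E' EE' H /= Uu Ww x Dx nx ux xw.
  apply: (H Uu Ww x Dx _ ux) => [xE|]; first by apply/nx/EE'.
  by apply: via_mono xw => // y [Dy ny]; split=> // yE; apply/ny/EE'.
- case: (classic (U u /\ W w)) => [[Uu Ww]|nUW]; last first.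
    by exists [::] => Uu Ww; case: nUW.
  have [|||S HS] := @pair_separator _ D u w (noinf u w).
  + by move=> e; apply: (UW u); split=> //; rewrite e.
  + by move=> Du; apply: (UD u).
  + by move=> Dw; apply: (WD w).
  by exists S => _ _; exact: HS.
exists S => u x w Uu Ww; apply: (HS (u, w)) => //.
by apply: in_prod; [apply: fU|apply: fW].
Qed.

(** * Splitting a linked pair *)

Definition disjoint_sets T (A B : T -> Prop) : Prop := forall x, A x -> ~ B x.

(** Two branch sets together with the region reserved for the branch sets between them. *)
Record cell (G : graph) := Cell {
  lft : vertex G -> Prop;
  rgt : vertex G -> Prop;
  body : vertex G -> Prop }.

Record good (G : graph) (U W D : vertex G -> Prop) : Prop := Good {
  good_finl : finite_set U;
  good_finr : finite_set W;
  good_connl : induced_connected U;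
  good_connr : induced_connected W;
  good_lr : disjoint_sets U W;
  good_lb : disjoint_sets U D;
  good_rb : disjoint_sets W D;
  good_adj : exists x y, [/\ U x, W y & adj x y];
  good_linked : linked U D W }.

(** [T] is the union of the components of [D] containing some [s] to which [U] is linked through
    [N]. If no vertex of [T] is linked to [W], finitely many edges cut the part of [S] in [T] from
    [W], and [U] from the part of [S] in [D] outside [T]. With the [U]-[W] edges added, they meet
    every [U]-[W] walk through [D]. *)
Lemma split_chain (G : graph) (U W D : vertex G -> Prop) S :
  finite_set U -> finite_set W ->
  (forall u x w, U u -> W w -> D x -> ~ In x S -> adj u x ->
    ~ via (@adj G) (fun y => D y /\ ~ In y S) x w) ->
  linked U D W ->
  let N x := D x /\ ~ In x S in
  exists s t, [/\ D s, D t, linked U N (eq s), linked (eq t) N W & reach D s t].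
Proof.
move=> [lU fU] [lW fW] sep lUW N.
pose T t := D t /\ exists s, [/\ D s, linked U N (eq s) & reach D s t].
apply: NNPP => none.
have noT t : T t -> ~ linked (eq t) N W.
  by move=> [Dt [s [Ds Us st]]] tW; apply: none; exists s, t.
have [E1 hE1] : exists E, forall t, In t S -> T t ->
    forall w, W w -> ~ via (adj_minus E) N t w.
  apply: (finite_bound (P := fun t E => T t -> forall w, W w -> ~ via (adj_minus E) N t w)).
    move=> t E E' EE' H Tt w Ww tw; apply: (H Tt w Ww).
    by apply: via_mono tw => // x y; apply: adj_minus_sub.
  move=> t _; case: (classic (T t)) => [Tt|]; last by exists [::].
  by have [E HE] := not_linked (noT t Tt); exists E => _ w; apply: HE.
have [E2 hE2] : exists E, forall s, In s S -> D s -> ~ T s ->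
    forall u, U u -> ~ via (adj_minus E) N u s.
  apply: (finite_bound
    (P := fun s E => D s -> ~ T s -> forall u, U u -> ~ via (adj_minus E) N u s)).
    move=> s E E' EE' H Ds nTs u Uu us; apply: (H Ds nTs u Uu).
    by apply: via_mono us => // x y; apply: adj_minus_sub.
  move=> s _; case: (classic (T s)) => [|nTs]; first by exists [::].
  case: (classic (D s)) => [Ds|]; last by exists [::].
  have [|E HE] := @not_linked _ U N (eq s).
    by move=> Us; apply: nTs; split=> //; exists s; split=> //; apply: rt_refl.
  by exists E => _ _ u Uu; apply: HE.
have TN t s : T t -> D s -> ~ T s -> ~ via (@adj G) N t s.
  move=> [Dt [r [Dr Ur rt]]] Ds nTs ts; apply: nTs; split=> //.
  exists r; split=> //; apply: rt_trans rt _; apply: via_reach => //.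
  by apply: via_mono ts => // ? [].
pose E := (E1 ++ E2 ++ list_prod lU lW)%list.
have [u [w [Uu Ww uw]]] := lUW E.
have E1E : incl E1 E by apply/incl_appl/incl_refl.
have E2E : incl E2 E by apply/incl_appr/incl_appl/incl_refl.
(* The walk is cut at its visits to [S]: each segment starts in [src] and runs through [N]. *)
pose src t := U t \/ In t S /\ T t.
have viaA t x : via (adj_minus E) N t x -> via (@adj G) N t x.
  by apply: via_mono => // ? ?; apply: adj_minus_adj.
have viaE E' t x : incl E' E -> via (adj_minus E) N t x -> via (adj_minus E') N t x.
  by move=> EE; apply: via_mono => // ? ?; apply: adj_minus_sub.
have noW t y : src t -> W y -> ~ via (adj_minus E) N t y.
  move=> [Ut|[St Tt]] Wy ty; last by apply: (hE1 t St Tt y Wy); apply: viaE ty.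
  (* A single edge from [U] to [W] is listed in [E]; a longer segment contradicts [sep]. *)
  case: ty Ut Wy => {t y} [t y [_ [nE _]] Ut Wy|t x y tx [Dx nSx] xy Ut Wy].
    apply: nE; apply/in_app_iff; right; apply/in_app_iff; right.
    by apply: in_prod; [apply: fU|apply: fW].
  by apply: (sep t x y) => //; [apply: adj_minus_adj tx|apply: viaA].
suff main : forall x y, via (adj_minus E) D x y -> W y ->
    (src x \/ N x /\ exists2 t, src t & via (adj_minus E) N t x) -> False.
  by apply: (main u w uw Ww); left; left.
have step x y : (src x \/ N x /\ exists2 t, src t & via (adj_minus E) N t x) ->
    adj_minus E x y -> exists2 t, src t & via (adj_minus E) N t y.
  move=> [sx|[Nx [t st tx]]] xy; first by exists x => //; apply: via_edge.
  by exists t => //; apply: via_rcons tx Nx xy.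
move=> a b ab Wb; elim: ab Wb => {u w uw Uu Ww a b} [x y xy|x y z xy Dy _ IH] Wy sx.
  by have [t st] := step _ _ sx xy; apply: noW.
have [t st ty] := step _ _ sx xy.
apply: (IH Wy); case: (classic (In y S)) => [Sy|nSy]; last by right; split=> //; exists t.
(* The visited vertex [y] of [S] lies in [T]: [E2] cuts [U] from the others, and a segment starting
   in [T] stays in its component of [D]. *)
left; right; split=> //; apply: NNPP => nTy.
case: st => [Ut|[St Tt]]; first by apply: (hE2 y Sy Dy nTy t Ut); apply: viaE ty.
by apply: (TN t y Tt Dy nTy); apply: viaA.
Qed.

(** Every walk from [U] to [s] through [N] only uses vertices that [U] reaches through [N], so
    restricting to these loses nothing. The restriction is what will make the two halves
    disjoint. *)
Lemma good_half (G : graph) (U M D D' N : vertex G -> Prop) s :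
  finite_set U -> finite_set M -> induced_connected U -> induced_connected M ->
  disjoint_sets U D -> (forall x, M x -> D x) -> (forall x, N x -> D x) ->
  (forall x, D' x <-> (N x /\ exists2 u, U u & via (@adj G) N u x) /\ ~ M x) ->
  M s -> linked U N (eq s) -> (exists x y, [/\ U x, M y & adj x y]) ->
  good U M D'.
Proof.
move=> fU fM cU cM UD MD ND D'E Ms lUs eUM; split=> //.
- by move=> x Ux /MD; apply: UD.
- by move=> x Ux /D'E[[/ND Dx _] _]; apply: (UD x).
- by move=> x Mx /D'E[_].
move=> E; have [u [_ [Uu <- us]]] := lUs E.
have via' x : via (adj_minus E) N x s ->
    (U x \/ exists2 u, U u & via (@adj G) N u x /\ N x) ->
    via (adj_minus E) (fun x => N x /\ exists2 u, U u & via (@adj G) N u x) x s.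
  elim=> {x us} [x y xy _|x y z xy Ny _ IH ux]; first exact: via_edge.
  have [u' Uu' uy] : exists2 u, U u & via (@adj G) N u y.
    have axy := adj_minus_adj xy.
    case: ux => [Ux|[u' Uu' [ux Nx]]]; first by exists x => //; apply: via_edge.
    by exists u' => //; apply: via_rcons ux Nx axy.
  apply: via_step xy _ (IH _); first by split=> //; exists u'.
  by right; exists u'.
have [s' Ms' us'] := via_truncate (via' u us (or_introl Uu)) Ms.
by exists u, s'; split=> //; apply: via_mono us' => // x ?; apply/D'E.
Qed.

Lemma good_sym (G : graph) (U W D : vertex G -> Prop) : good U W D -> good W U D.
Proof.
case=> fU fW cU cW UW UD WD [x [y [Ux Wy xy]]] lUW; split=> //.
- by move=> z Wz Uz; apply: (UW z).
- by exists y, x; split=> //; apply: adj_sym.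
- exact: linked_sym.
Qed.

Lemma linked_neighbour (G : graph) (U N D : vertex G -> Prop) s :
  linked U N (eq s) -> (forall x, N x -> D x) -> D s ->
  exists u x, [/\ U u, adj u x, D x & reach D s x].
Proof.
move=> lUs ND Ds; have [u [_ [Uu <- us]]] := lUs [::].
have {us} us : via (@adj G) D u s.
  by apply: via_mono us => // ? ?; apply: adj_minus_adj.
case: us Uu Ds => {u s lUs} [u s us|u x s ux Dx xs] Uu Ds.
  by exists u, s; split=> //; apply: rt_refl.
by exists u, x; split=> //; apply: reach_sym; apply: via_reach.
Qed.

Lemma good_split (G : graph) (U W D : vertex G -> Prop) :
  (forall u v : vertex G, ~ inf_indep_paths u v) -> good U W D ->
  exists M D1 D2, [/\ good U M D1, good M W D2, forall x, M x -> D x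
    & (forall x, D1 x -> D x) /\ (forall x, D2 x -> D x) /\ disjoint_sets D1 D2].
Proof.
move=> noinf [fU fW cU cW UW UD WD _ lUW].
have [|||S sep] := finite_separator (D := D) noinf fU fW.
- by move=> x [Ux Wx]; apply: (UW x).
- by move=> x [Ux Dx]; apply: (UD x).
- by move=> x [Ux Dx]; apply: (WD x).
have [s [t [Ds Dt Us tW st]]] := split_chain fU fW sep lUW.
set N := fun x => _ in Us tW.
have ND x : N x -> D x by case.
have Wt := linked_sym tW.
have [u [x [Uu ux Dx sx]]] := linked_neighbour Us ND Ds.
have [w [y [Ww wy Dy ty]]] := linked_neighbour Wt ND Dt.
(* [s] and [t] provide the links of [M], while [x] and [y] make it adjacent to [U] and [W]. *)
have [|M [fM cM MD Ms Ml]] := @connected_hull _ D s [:: t; x; y] Ds.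
  move=> z [<-//|[<-//|[<-|//]]]; exact: rt_trans st ty.
have [Mt Mx My] : [/\ M t, M x & M y] by split; apply: Ml; rewrite /=; tauto.
pose D' (U : vertex G -> Prop) z :=
  (N z /\ exists2 u, U u & via (@adj G) N u z) /\ ~ M z.
exists M, (D' U), (D' W); split=> //.
- by apply: (good_half (s := s) (N := N) (D := D)) => //; exists u, x.
- apply: good_sym; apply: (good_half (s := t) (N := N) (D := D)) => //.
  by exists w, y.
split; last split; try by move=> z [[/ND]].
(* A vertex in both halves would give a [U]-[W] walk through [N], against [sep]. *)
move=> z [[Nz [u' Uu' uz]] _] [[_ [w' Ww' wz]] _].
have zw : via (@adj G) N z w' by apply: via_sym wz; apply: adj_sym.
case: uz Uu' Nz zw => {u' z wz} [a b ab|a c b ac Nc cb] Ua Nb bw.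
  by apply: (sep a b w'); case: (Nb).
apply: (sep a c w'); case: (Nc) => // Dc nSc.
exact: via_trans cb Nb bw.
Qed.

(** * Branch sets of fractions *)

Definition good_cell (G : graph) (c : cell G) := good (lft c) (rgt c) (body c).

(** The shared sets are equal as predicates, so that a branch set can be rewritten from one cell to
    a neighbouring one. *)
Record good_children (G : graph) (c c1 c2 : cell G) : Prop := GoodChildren {
  child1_good : good_cell c1;
  child2_good : good_cell c2;
  child1_lft : lft c1 = lft c;
  child2_rgt : rgt c2 = rgt c;
  child_mid : rgt c1 = lft c2;
  child_mid_body : forall x, rgt c1 x -> body c x;
  child1_body : forall x, body c1 x -> body c x;
  child2_body : forall x, body c2 x -> body c x;
  child_disjoint : disjoint_sets (body c1) (body c2) }.

Definition splitting (G : graph) (split : cell G -> cell G * cell G) : Prop :=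
  forall c, good_cell c -> good_children c (split c).1 (split c).2.

Lemma splitting_exists (G : graph) :
  (forall u v : vertex G, ~ inf_indep_paths u v) ->
  exists split : cell G -> cell G * cell G, splitting split.
Proof.
move=> noinf.
apply: (functional_choice (fun c cc => good_cell c -> good_children c cc.1 cc.2)) => c.
case: (classic (good_cell c)) => [gc|]; last by exists (c, c).
have [M [D1 [D2 [g1 g2 MD [D1D [D2D D12]]]]]] := good_split noinf gc.
by exists (Cell (lft c) M D1, Cell M (rgt c) D2) => _; split.
Qed.

Fixpoint branch_fuel (G : graph) (split : cell G -> cell G * cell G) (n : nat)
    (c : cell G) (a b : nat) : vertex G -> Prop :=
  match n with
  | 0 => lft c
  | n'.+1 =>
    if a == 0 then lft c else if b == 0 then rgt c
    else if a <= b then branch_fuel split n' (split c).1 a (b - a)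
    else branch_fuel split n' (split c).2 (a - b) b
  end.

(* The branch set of the fraction a/b, found by the Euclidean algorithm: the cell
   stands for the interval [0, oo], and its two children for [0, 1] and [1, oo],
   rescaled to [0, oo] by a/b |-> a/(b-a) and a/b |-> (a-b)/b. *)
Definition branch (G : graph) (split : cell G -> cell G * cell G) (c : cell G)
    (a b : nat) := branch_fuel split (a + b) c a b.

(** Each subtraction lowers [a + b]. Within the bound, no fuel means [a = 0], where [lft c] is the
    correct value. *)
Lemma branch_fuelE (G : graph) (split : cell G -> cell G * cell G) n c a b :
  a + b <= n -> branch_fuel split n c a b = branch split c a b.
Proof.
move=> hn; rewrite /branch; have [m hm] : exists m, a + b = m by exists (a + b).
rewrite hm; have {hm} : a + b <= m by rewrite hm.
elim: n m c a b hn => [|n IH] [|m] c a b hn hm //=.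
- by have -> : a = 0 by lia.
- by have -> : a = 0 by lia.
case: eqP => // a0; case: eqP => // b0.
by case: ifP => ab; rewrite (IH m) //; lia.
Qed.

Lemma branch0 (G : graph) (split : cell G -> cell G * cell G) c b :
  branch split c 0 b = lft c.
Proof. by rewrite /branch; case: (0 + b). Qed.

Lemma branchoo (G : graph) (split : cell G -> cell G * cell G) c a :
  0 < a -> branch split c a 0 = rgt c.
Proof. by case: a => // a _; rewrite /branch addn0. Qed.

Lemma branch_left (G : graph) (split : cell G -> cell G * cell G) c a b :
  splitting split -> good_cell c -> a <= b ->
  branch split c a b = branch split (split c).1 a (b - a).
Proof.
move=> sp gc ab; case: (posnP a) => [->|a0].
  by rewrite !branch0 (child1_lft (sp c gc)).
rewrite -(@branch_fuelE _ _ (a + b).-1.+1) /=; last by lia.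
rewrite ab; case: eqP => [|_]; first lia.
by case: eqP => [|_]; [lia|rewrite branch_fuelE //; lia].
Qed.

(** The boundary is included: for [b = 0] the right end is shared with the child, and for [a = b]
    both sides are the middle set. *)
Lemma branch_right (G : graph) (split : cell G -> cell G * cell G) c a b :
  splitting split -> good_cell c -> b <= a -> 0 < a ->
  branch split c a b = branch split (split c).2 (a - b) b.
Proof.
move=> sp gc ba a0; case: (posnP b) => [->|b0].
  by rewrite subn0 !branchoo // (child2_rgt (sp c gc)).
have [ab|ab] := leqP a b.
  have -> : a = b by lia.
  by rewrite branch_left // subnn branch0 branchoo // (child_mid (sp c gc)).
rewrite -(@branch_fuelE _ _ (a + b).-1.+1) /=; last by lia.
case: eqP => [|_]; first lia; case: eqP => [|_]; first lia.
by rewrite leqNgt ab /= branch_fuelE //; lia.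
Qed.

(** Through this, every branch set inherits finiteness, connectedness and non-emptiness from
    [good]. *)
Lemma branch_end (G : graph) (split : cell G -> cell G * cell G) c a b :
  splitting split -> good_cell c ->
  exists2 c', good_cell c' & branch split c a b = lft c' \/ branch split c a b = rgt c'.
Proof.
move=> sp; have [n] := ubnP (a + b); elim: n c a b => // n IH c a b abn gc.
case: (posnP a) => [->|a0]; first by exists c; rewrite ?branch0; auto.
case: (posnP b) => [->|b0]; first by exists c; rewrite ?branchoo; auto.
have [ab|ba] := leqP a b.
  by rewrite branch_left //; apply: IH; [lia|apply: child1_good (sp c gc)].
rewrite branch_right //; last exact: ltnW.
by apply: IH; [lia|apply: child2_good (sp c gc)].
Qed.

Lemma branch_body (G : graph) (split : cell G -> cell G * cell G) c a b x :
  splitting split -> good_cell c -> 0 < a -> 0 < b ->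
  branch split c a b x -> body c x.
Proof.
move=> sp; have [n] := ubnP (a + b).
elim: n c a b => // n IH c a b abn gc a0 b0.
have cc := sp c gc.
have [ab|ba] := leqP a b.
  rewrite branch_left //; have [e|ba] := posnP (b - a).
    by rewrite e branchoo //; apply: child_mid_body cc x.
  by move/IH=> H; apply: (child1_body cc); apply: H => //; [lia|apply: child1_good cc].
rewrite branch_right //; last exact: ltnW.
by move/IH=> H; apply: (child2_body cc); apply: H => //; [lia|apply: child2_good cc|lia].
Qed.

(** Let a/b < d/e. Two fractions on the same side of 1 descend to one child, with a*e - b*d
    unchanged. Otherwise the bodies of the two children separate them, or one is 0, 1 or oo and its
    branch set is an end of a cell. *)
Lemma branch_disjoint (G : graph) (split : cell G -> cell G * cell G) k a b d e :
  splitting split -> good_cell k -> a * e <> b * d ->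
  disjoint_sets (branch split k a b) (branch split k d e).
Proof.
move=> sp; have [n] := ubnP (a + b + d + e).
elim: n k a b d e => // n IH k a b d e abn gk neq x.
have ordered a' b' d' e' : a' + b' + d' + e' < n.+1 -> a' * e' <> b' * d' ->
    a' * e' < b' * d' ->
    branch split k a' b' x -> ~ branch split k d' e' x.
  move=> {a b d e abn neq} abn neq lt; have kk := sp k gk.
  case: (posnP a') => [a0|a0].
    subst a'; rewrite branch0 => Ux.
    have d0 : 0 < d' by nia.
    case: (posnP e') => [->|e0]; first by rewrite branchoo // => /(good_lr gk).
    by move/(branch_body sp gk d0 e0); apply: good_lb gk x Ux.
  have b0 : 0 < b' by nia.
  case: (posnP e') => [->|e0].
    move/(branch_body sp gk a0 b0) => Dx; rewrite branchoo; last by nia.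
    by move/(good_rb gk).
  have g1 := child1_good kk; have g2 := child2_good kk.
  have [ab|/ltnW ba] := leqP a' b'; have [de|ed] := leqP d' e'.
  - rewrite (branch_left sp gk ab) (branch_left sp gk de).
    by apply: IH => //; [lia|nia].
  - rewrite (branch_left sp gk ab) (branch_right sp gk (ltnW ed)); last by lia.
    move=> X Y; have {}Y := branch_body sp g2 _ _ Y.
    have [e1|ba] := posnP (b' - a').
      move: X; rewrite e1 branchoo // (child_mid kk) => X.
      by apply: (good_lb g2 X); apply: Y; lia.
    by apply: (child_disjoint kk (branch_body sp g1 a0 ba X)); apply: Y; lia.
  - by nia.
  - rewrite (branch_right sp gk ba a0) (branch_right sp gk (ltnW ed)); last by lia.
    by apply: IH => //; [lia|nia].
case: (ltngtP (a * e) (b * d)) => // lt; first exact: ordered.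
move=> X Y; apply: (ordered d e a b _ _ _ Y X); lia.
Qed.

(** Descending preserves the determinant. If 1 lies strictly between the fractions, then (a+1)(e+1)
    <= b*d = a*e + 1 forces a = e = 0, which leaves 0/1 and 1/0, the adjacent ends of a cell. *)
Lemma branch_adj (G : graph) (split : cell G -> cell G * cell G) c a b d e :
  splitting split -> good_cell c -> a * e + 1 = b * d ->
  exists x y, [/\ branch split c a b x, branch split c d e y & adj x y].
Proof.
move=> sp; have [n] := ubnP (a + b + d + e).
elim: n c a b d e => // n IH c a b d e abn gc det.
have cc := sp c gc; have g1 := child1_good cc; have g2 := child2_good cc.
have b0 : 0 < b by nia.
have d0 : 0 < d by nia.
have [ab|/ltnW ba] := leqP a b; have [de|ed] := leqP d e.
- rewrite (branch_left sp gc ab) (branch_left sp gc de).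
  by apply: IH => //; nia.
- have [ba|{}ab] := leqP b a.
    have a0 : 0 < a by lia.
    rewrite (branch_right sp gc ba a0) (branch_right sp gc (ltnW ed) d0).
    by apply: IH => //; nia.
  have [a0 e0] : a = 0 /\ e = 0 by nia.
  by subst; rewrite branch0 branchoo //; apply: good_adj gc.
- by nia.
have a0 : 0 < a by lia.
rewrite (branch_right sp gc ba a0) (branch_right sp gc (ltnW ed) d0).
by apply: IH => //; nia.
Qed.

(** * Gluing two halves into the Farey graph *)

Lemma good_extend (G : graph) (U V M D : vertex G -> Prop) :
  good U M D -> finite_set V -> induced_connected V ->
  (exists x y, [/\ U x, V y & adj x y]) ->
  disjoint_sets V M -> disjoint_sets V D ->
  good (fun x => U x \/ V x) M D.
Proof.
case=> fU fM cU cM UM UD MD [x [y [Ux My xy]]] lUM fV cV [u [v [Uu Vv uv]]] VM VD.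
split=> //.
- exact: finite_union.
- by apply: connected_union Uu Vv _; auto.
- by move=> z [/UM|/VM].
- by move=> z [/UD|/VD].
- by exists x, y; split=> //; left.
by move=> E; have [u' [m [Uu' Mm um]]] := lUM E; exists u', m; split=> //; left.
Qed.

(** Keep the piece from the last visit to [a] up to the next visit to [b]. *)
Lemma via_of_walk V (R : V -> V -> Prop) a b :
  clos_refl_trans V R a b -> a <> b -> via R (fun x => x <> a /\ x <> b) a b.
Proof.
move=> ab neq.
suff last_visit x y : clos_refl_trans_1n V R x y ->
    x = y \/ (exists2 z, z = x \/ z = a & via R (fun x => x <> a /\ x <> y) z y).
  by have [//|[z [->|->]]] := last_visit a b (clos_rt_rt1n _ _ _ _ ab).
elim=> {x y} [x|x y z xy _ IH]; first by left.
right; case: IH => [<-|[t [->|->] tz]]; first by exists x; [left|apply: via_edge].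
  case: (classic (y = a)) => [ya|ya]; first by rewrite ya in tz; exists a; auto.
  case: (classic (y = z)) => [<-|yz]; first by exists x; [left|apply: via_edge].
  by exists x; [left|apply: via_step xy _ tz].
by exists a; auto.
Qed.

Lemma linked_points (G : graph) (a b : vertex G) :
  inf_edge_connected G -> a <> b -> linked (eq a) (fun x => x <> a /\ x <> b) (eq b).
Proof. by move=> [_ conn] ab E; exists a, b; split=> //; exact: via_of_walk (conn E a b) ab. Qed.

Lemma edge_exists (G : graph) : inf_edge_connected G -> exists a b : vertex G, adj a b.
Proof.
move=> [[a [b ab]] conn].
by case: (clos_rt_rt1n _ _ _ _ (conn [::] a b)) ab => // y z [ay _]; exists a, y.
Qed.

(** [cm] is mirrored: a/b in it stands for -a/b. Both cells are meant to share the left set, for 0,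
    and the right set, for oo. *)
Definition farey_branch (G : graph) (split : cell G -> cell G * cell G)
    (cp cm : cell G) (h : option rat) : vertex G -> Prop :=
  match h with
  | None => rgt cp
  | Some q => branch split (if (0 <= numq q)%R then cp else cm) `|numq q| `|denq q|
  end.

Lemma farey_model (G : graph) (split : cell G -> cell G * cell G) (cp cm : cell G) :
  splitting split -> good_cell cp -> good_cell cm -> lft cp = lft cm ->
  rgt cp = rgt cm -> disjoint_sets (body cp) (body cm) ->
  minor_model Farey G (farey_branch split cp cm).
Proof.
move=> sp gp gm elft ergt disj.
have good_end h : exists2 c, good_cell c &
    farey_branch split cp cm h = lft c \/ farey_branch split cp cm h = rgt c.
  case: h => [q|] /=; last by exists cp; auto.
  by apply: branch_end => //; case: ifP.
have rgtp : rgt cp = branch split cp 1 0 by rewrite branchoo.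
have rgtm : rgt cp = branch split cm 1 0 by rewrite branchoo.
have disj_oo (q : rat) : disjoint_sets (rgt cp) (farey_branch split cp cm (Some q)).
  rewrite /farey_branch; have := denq_gt0 q.
  by case: ifP => _ d0; [rewrite rgtp|rewrite rgtm]; apply: branch_disjoint => //; lia.
have adj_oo (q : rat) : `|denq q|%R = 1%R ->
    exists x y, [/\ farey_branch split cp cm (Some q) x, rgt cp y & adj x y].
  rewrite /farey_branch => d1.
  by case: ifP => _; [rewrite rgtp|rewrite rgtm]; apply: branch_adj => //; lia.
split; last split; last split.
- move=> h h' neq x; case: h h' neq => [p|] [q|] neq [].
  + have {}neq : (numq p * denq q <> denq p * numq q)%R.
      by move=> e; apply: neq; congr Some; apply/eqP; rewrite rat_eq e mulrC.
    have := denq_gt0 p; have := denq_gt0 q; rewrite /farey_branch.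
    case: ifP => p0; case: ifP => q0 dp dq; try by apply: branch_disjoint => //; nia.
    (* Non-zero rationals of opposite sign have branch sets in disjoint bodies; 0 is moved to the
       other cell by [elft]. *)
    * case: (posnP `|numq p|) => [->|np]; last first.
        move/(branch_body sp gp) => X /(branch_body sp gm) Y.
        by apply: (disj x (X _ _) (Y _ _)); lia.
      by rewrite branch0 elft -(branch0 split _ 1); apply: branch_disjoint => //; nia.
    * case: (posnP `|numq q|) => [->|np]; last first.
        move/(branch_body sp gm) => X /(branch_body sp gp) Y.
        by apply: (disj x (Y _ _) (X _ _)); lia.
      by rewrite branch0 elft -(branch0 split _ 1); apply: branch_disjoint => //; nia.
  + by move=> X Y; apply: disj_oo Y X.
  + by move=> X Y; apply: disj_oo X Y.
  + by [].
- move=> h; have [c gc br] := good_end h; have [x [y [Ux Wy _]]] := good_adj gc.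
  by case: br => ->; [exists x|exists y].
- move=> h; have [c gc [->|->]] := good_end h.
    exact: good_connl gc.
  exact: good_connr gc.
move=> [p|] [q|] //=; last 2 first.
- by move/adj_oo=> [x [y [X Y xy]]]; exists x, y.
- by move/adj_oo=> [x [y [X Y xy]]]; exists y, x; do !split=> //; apply: adj_sym.
move=> det; have := denq_gt0 p; have := denq_gt0 q.
  rewrite /farey_branch => dq dp.
  have adj_branch c a b d e : good_cell c -> a * e + 1 = b * d \/ b * d + 1 = a * e ->
      exists x y, branch split c a b x /\ branch split c d e y /\ adj x y.
    move=> gc [det'|det'].
      by have [x [y [X Y xy]]] := branch_adj sp gc det'; exists x, y.
    have [|x [y [X Y xy]]] := @branch_adj _ split c d e a b sp gc; first by lia.
    by exists y, x; do !split=> //; apply: adj_sym.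
  case: ifP => p0; case: ifP => q0; try by apply: adj_branch => //; nia.
  (* With [p >= 0 > q] the determinant is a sum of a non-negative and a positive term, so value 1
     forces [p = 0]. *)
  + have h1 : (numq p <= numq p * denq q)%R by nia.
    have h2 : (denq p * numq q <= - 1)%R by nia.
    have -> : `|numq p| = 0 by lia.
    by rewrite branch0 elft -(branch0 split _ `|denq p|); apply: adj_branch => //; nia.
  + have h1 : (numq q <= denq p * numq q)%R by nia.
    have h2 : (numq p * denq q <= - 1)%R by nia.
    have -> : `|numq q| = 0 by lia.
    by rewrite branch0 elft -(branch0 split _ `|denq q|); apply: adj_branch => //; nia.
Qed.

Lemma farey_tight_minor (G : graph) : Pi_graph G -> tight_minor Farey G.
Proof.
move=> [iec noinf].
have [split sp] := splitting_exists noinf.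
have [u [w uw]] := edge_exists iec.
have neq : u <> w by move=> e; rewrite e in uw; apply: adj_irrefl uw.
pose c := Cell (eq u) (eq w) (fun x => x <> u /\ x <> w).
have gc : good_cell c.
  split; rewrite /=; try exact: finite_single; try exact: connected_single.
  - by move=> x <- e; apply: neq.
  - by move=> x <- [].
  - by move=> x <- [].
  - by exists u, w.
  exact: linked_points.
have [c1 [c2 cc]] : exists c1 c2, good_children c c1 c2.
  by exists (split c).1, (split c).2; apply: sp.
have g1 := child1_good cc; have g2 := child2_good cc.
have l1 := child1_lft cc; have r2 := child2_rgt cc; have mid := child_mid cc.
(* [M] becomes the branch set of oo, and the contracted edge [U] that of 0. The second half is
   turned around to have [U] on its left as well. *)
pose M := rgt c1; pose U x := u = x \/ w = x.
have wu : exists x y, [/\ w = x, u = y & adj x y].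
  by exists w, u; split=> //; apply: adj_sym.
have gp : good_cell (Cell U M (body c1)).
  apply: good_extend => /=.
  - by have := g1; rewrite /good_cell l1.
  - exact: finite_single.
  - exact: connected_single.
  - by exists u, w.
  - by move=> x <- /(child_mid_body cc)[].
  - by move=> x <- /(child1_body cc)[].
have gm : good_cell (Cell U M (body c2)).
  have -> : U = (fun x => w = x \/ u = x).
    apply: functional_extensionality => x; apply: propositional_extensionality.
    by rewrite /U; tauto.
  apply: good_extend => //=.
  - by apply: good_sym; have := g2; rewrite /good_cell r2 -mid.
  - exact: finite_single.
  - exact: connected_single.
  - by move=> x <- /(child_mid_body cc)[].
  - by move=> x <- /(child2_body cc)[].
exists (farey_branch split (Cell U M (body c1)) (Cell U M (body c2))); split.
  by apply: farey_model => //; apply: child_disjoint cc.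
case=> [q|] /=; last exact: good_finr gp.
case: ifP => _.
  have [c' gc' [->|->]] := branch_end `|numq q| `|denq q| sp gp.
    exact: good_finl gc'.
  exact: good_finr gc'.
have [c' gc' [->|->]] := branch_end `|numq q| `|denq q| sp gm.
  exact: good_finl gc'.
exact: good_finr gc'.
Qed.

(** * Separating two vertices of the Farey graph *)

Local Open Scope ring_scope.

Definition fnum (h : option rat) : int := if h is Some q then numq q else 1.
Definition fden (h : option rat) : int := if h is Some q then denq q else 0.
Definition fdet (x y : option rat) : int := fnum x * fden y - fden x * fnum y.

Lemma farey_adjE x y : farey_adj x y <-> `|fdet x y| = 1.
Proof.
rewrite /fdet; case: x y => [p|] [q|] //=; first by rewrite mulr0 sub0r mulr1 normrN.
by rewrite mul1r mul0r subr0.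
Qed.

Lemma fdet_eq0 x y : fdet x y = 0 -> x = y.
Proof.
rewrite /fdet; case: x y => [p|] [q|] //=.
- by move/subr0_eq => e; congr Some; apply/eqP; rewrite rat_eq e mulrC.
- by have := denq_gt0 p; lia.
- by have := denq_gt0 q; lia.
Qed.

(** Bezout completes [u] to a basis of Z^2. *)
Lemma fdet_complement u : exists c d, fnum u * d - fden u * c = 1.
Proof.
case: u => [q|] /=; last by exists 0, 1; lia.
have [a [b ab]] := Bezoutz (numq q) (denq q).
exists (- b), a; have := coprime_num_den q; rewrite /coprime => /eqP g.
by rewrite mulrN opprK mulrC [denq q * b]mulrC ab /gcdz g.
Qed.

Lemma slope_interval (i j : int) : i != 0 ->
  exists m n : int, [/\ 0 < (j - m * i) * i, 0 < (n * i - j) * i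
    & forall k, m < k -> k < n -> j = k * i].
Proof.
wlog i0 : i j / 0 < i => [H|_].
  move=> ine; case: (ltgtP 0 i) => i0; [exact: H| |by rewrite -i0 in ine].
  have [||m [n [h1 h2 h3]]] := H (- i) (- j); [lia|lia|].
  by exists m, n; split; [lia|lia|move=> k k1 k2; have := h3 k k1 k2; lia].
have e1 := divz_eq j i; have e2 := divz_eq (- j) i.
have l1 := ltz_pmod j i0; have l2 := ltz_pmod (- j) i0.
have ine : i != 0 by lia.
have g1 := modz_ge0 j ine; have g2 := modz_ge0 (- j) ine.
(* These are ceil(j/i) - 1 and floor(j/i) + 1. *)
exists (- (- j %/ i)%Z - 1), ((j %/ i)%Z + 1).
move: e1 e2 l1 l2 g1 g2.
move: (j %/ i)%Z (j %% i)%Z (- j %/ i)%Z (- j %% i)%Z => q r q' r' e1 e2 l1 l2 g1 g2.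
by split; nia.
Qed.

(* The slope j/i lies strictly between m and n. *)
Definition between (m n i j : int) : Prop := 0 < (j - m * i) * i /\ 0 < (n * i - j) * i.

(** [a * d] and [c * b] are non-zero integers of opposite sign. *)
Lemma mul_sign_gt1 (a b c d : int) : 0 < a * c -> b * d < 0 -> 1 < `|a * d - c * b|.
Proof.
move=> ac bd.
have : (a * d) * (c * b) < 0 by rewrite mulrACA nmulr_llt0 //; lia.
move: (a * d) (c * b) => x y xy; nia.
Qed.

(** The shear replacing j by j - m*i keeps the determinant up to sign. A neighbour beyond m would
    then have opposite slope sign, hence a determinant of absolute value at least 2; likewise for
    n. *)
Lemma between_step m n i j i' j' : between m n i j -> `|j * i' - i * j'| = 1 ->
  i' != 0 -> j' != m * i' -> j' != n * i' -> between m n i' j'.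
Proof.
move=> [h1 h2] det i0 jm jn; split; rewrite ltNge; apply/negP => h.
  have : (j' - m * i') * i' < 0 by rewrite lt_neqAle h mulf_neq0 // subr_eq0.
  move/(mul_sign_gt1 h1).
  have -> : (j - m * i) * i' - i * (j' - m * i') = j * i' - i * j' by ring.
  by rewrite det.
have : (n * i' - j') * i' < 0 by rewrite lt_neqAle h mulf_neq0 // subr_eq0 eq_sym.
move/(mul_sign_gt1 h2).
have -> : (n * i - j) * i' - i * (n * i' - j') = - (j * i' - i * j') by ring.
by rewrite normrN det.
Qed.

Lemma between_integral m n i j : between m n i j -> `|i| = 1 ->
  exists2 k, j = k * i & m < k < n.
Proof.
rewrite /between => -[h1 h2] i1; have [e|e] : i = 1 \/ i = -1 by lia.
  by exists j; rewrite e in h1 h2 *; lia.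
by exists (- j); rewrite e in h1 h2 *; lia.
Qed.

(** [J x / I x] is the slope of [x], infinite at [u]. Neighbours of [u] have integral slope, and an
    integer strictly between [m] and [n] is the slope of [v]. An edge leaves the interval only to
    [u] or to slope [m] or [n], and each slope has at most one vertex. *)
Lemma farey_barrier (u v : option rat) : u <> v ->
  exists A Q : option rat -> Prop,
    [/\ A v, forall x, A x -> ~ Q x /\ (farey_adj x u -> x = v),
      forall x y, A x -> farey_adj x y -> [\/ y = u, Q y | A y]
    & finite_set Q].
Proof.
move=> uv; have [c [d cd]] := fdet_complement u.
pose I x := fdet u x; pose J x := fnum x * d - fden x * c.
have detE x y : fdet x y = J x * I y - I x * J y.
  rewrite -[LHS]mul1r -cd /fdet /I /J /fdet; ring.
have Iv : I v != 0 by apply/eqP=> /fdet_eq0.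
have [m [n [h1 h2 h3]]] := slope_interval (J v) Iv.
exists (fun x => between m n (I x) (J x)).
exists (fun x => J x = m * I x \/ J x = n * I x); split=> //.
- move=> x Ax; split.
    by case: (Ax) => a1 a2 [e|e]; [move: a1|move: a2]; rewrite e subrr mul0r ltxx.
  move=> /farey_adj_sym/farey_adjE Ix1.
  have [k e /andP[mk kn]] := between_integral Ax Ix1.
  by apply: fdet_eq0; rewrite detE e (h3 k mk kn); ring.
- move=> x y Ax /farey_adjE; rewrite detE => det.
  have [/fdet_eq0 ->|Iy] := eqVneq (I y) 0; first exact: Or31.
  have [e|e1] := eqVneq (J y) (m * I y); first by apply: Or32; left.
  have [e|e2] := eqVneq (J y) (n * I y); first by apply: Or32; right.
  by apply: Or33; apply: between_step Ax det _ _ _.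
have fin k : finite_set (fun x => J x = k * I x).
  case: (classic (exists x, J x = k * I x)) => [[x ex]|none].
    exists [:: x] => y ey; left; apply: fdet_eq0; rewrite detE ex ey; ring.
  by exists [::] => x ex; apply: none; exists x.
have [[l1 H1] [l2 H2]] := (fin m, fin n).
by exists (l1 ++ l2)%list => x [/H1|/H2] ?; apply/in_app_iff; [left|right].
Qed.

(** Followed backwards from [v], a chain can leave [A] only through [u] or [Q]. *)
Lemma chain_barrier (u v : option rat) (A Q : option rat -> Prop) l :
  A v ->
  (forall x y, A x -> farey_adj x y -> [\/ y = u, Q y | A y]) ->
  last l u = v -> @adj_chain Farey l -> ~ In u l -> (forall x, In x l -> ~ Q x) ->
  A (hd v l).
Proof.
move=> Av step; elim: l => [//|x [|y l] IH] /= lv ch nu nQ; first by rewrite lv.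
have [xy ch'] := ch.
have Ay : A y by apply: IH => //; [move=> ?; apply: nu; right|move=> z zl; apply: nQ; right].
have [xu|Qx|//] := step y x Ay (farey_adj_sym xy).
  by case: nu; left.
by case: (nQ x) => //; left.
Qed.

Lemma no_injection_finite T (l : list T) (f : nat -> T) :
  (forall n, In (f n) l) -> exists m n, m <> n /\ f m = f n.
Proof.
move=> fl; apply: NNPP => ninj.
have inj m n : f m = f n -> m = n.
  by move=> e; apply: NNPP => mn; apply: ninj; exists m, n.
have nd : List.NoDup (List.map f (List.seq 0 (List.length l).+1)).
  by apply: FinFun.Injective_map_NoDup; [exact: inj|exact: seq_NoDup].
have /(NoDup_incl_length nd) : incl (List.map f (List.seq 0 (List.length l).+1)) l.
  by move=> x /in_map_iff[n [<- _]]; apply: fl.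
by rewrite length_map length_seq; lia.
Qed.

Lemma NoDup_last_hd T (v : T) l d : NoDup (v :: l) -> last (v :: l) d = v -> l = [::].
Proof.
case: l => // x l /NoDup_cons_iff[nv _] lv; case: nv; rewrite -{}lv /=.
by elim: l x => [|y l IH] x; [left|right; apply: IH].
Qed.

Lemma farey_no_inf_indep (u v : vertex Farey) : ~ inf_indep_paths u v.
Proof.
move=> [f [fp [finj fdisj]]].
have fcons n : exists l, f n = u :: l.
  by have [] := fp n; case: (f n) => //= x l [->]; exists l.
case: (classic (u = v)) => [uv|uv].
  have f0 n : f n = [:: u].
    have [l e] := fcons n; have [_ [lv [nd _]]] := fp n.
    by rewrite e in lv nd *; rewrite -uv in lv; rewrite (NoDup_last_hd nd lv).
  by apply: (finj 0%N 1%N) => //; rewrite !f0.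
have [A [Q [Av AQ step [l0 Ql0]]]] := farey_barrier uv.
(* Each path is labelled by an inner vertex in [Q], or by [None] if it is the edge from [u] to [v].
   The labels are finitely many, so two paths share one. *)
have hit n : exists o, In o (None :: List.map Some l0) /\
    match o with None => f n = [:: u; v] | Some x => inner u v (f n) x end.
  have [l e] := fcons n; have [_ [lv [nd ch]]] := fp n; rewrite e in lv nd ch *.
  have [nu ndl] := proj1 (NoDup_cons_iff _ _) nd.
  case: (classic (exists2 x, In x l & Q x)) => [[x xl Qx]|nQ].
    exists (Some x); split; first by right; apply: in_map; apply: Ql0.
    split; [by right|split=> ex; subst x; first by []].
    by case: (AQ v Av).
  exists None; split; first by left.
  case: l e lv nd ch nu ndl nQ => [|x l] e lv nd ch nu ndl nQ.
    by case: uv.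
  have [ux ch'] := ch.
  have Ax : A x.
    apply: (chain_barrier (l := x :: l) Av step) => // y yl Qy.
    by apply: nQ; exists y.
  have exv : x = v by apply: (AQ x Ax).2; apply: farey_adj_sym.
  by subst x; rewrite (@NoDup_last_hd _ v l u).
have [g Hg] := functional_choice _ hit.
have [m [n [mn e]]] := no_injection_finite (fun n => (Hg n).1).
have [[_ hm] [_ hn]] := (Hg m, Hg n); rewrite -e in hn.
case: (g m) hm hn => [x|] hm hn; first by apply: (fdisj m n mn x).
by apply: (finj m n mn); rewrite hm hn.
Qed.

(** * Edge-connectivity of the Farey graph *)

Definition fsize (h : option rat) : nat := (`|fnum h| + `|fden h|)%N.

(** With the sign kept apart in [s], mediants are sums of naturals. Both signs give the same oo. *)
Definition vtx (s : bool) (a b : nat) : option rat :=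
  if b is 0%N then None else Some (((-1) ^+ s * a%:Z)%:~R / b%:Z%:~R).

Lemma vtx_coprime s a b : coprime a b ->
  (b = 0%N /\ a = 1%N \/ (0 < b)%N /\ fnum (vtx s a b) = (-1) ^+ s * a%:Z) /\
  fden (vtx s a b) = b%:Z.
Proof.
case: b => [|b] ab /=.
  by move: ab; rewrite /coprime gcdn0 => /eqP->; split=> //; left.
have cop : coprime (absz ((-1) ^+ s * a%:Z)) (absz b.+1%:Z) by rewrite abszMsign.
by rewrite coprimeq_den // coprimeq_num //; split=> //; right; split=> //; lia.
Qed.

Lemma vtx_size s a b : coprime a b -> fsize (vtx s a b) = (a + b)%N.
Proof.
move/(vtx_coprime s); rewrite /fsize; case: b => [|b].
  by case=> [[[_ ->]|[//]] _].
by case=> [[[//]|[_ ->]] ->]; rewrite abszMsign.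
Qed.

Lemma det_coprime a b c d : (a * d = b * c + 1)%N -> coprime a b /\ coprime c d.
Proof.
move=> det; have co x y : (x %| y -> x %| y + 1 -> x = 1)%N.
  by move=> xy; rewrite dvdn_addr // dvdn1 => /eqP.
split; apply/eqP; apply: (co _ (b * c)%N).
- by rewrite dvdn_mulr ?dvdn_gcdr.
- by rewrite -det dvdn_mulr ?dvdn_gcdl.
- by rewrite dvdn_mull ?dvdn_gcdl.
- by rewrite -det dvdn_mull ?dvdn_gcdr.
Qed.

Lemma vtx_adj s a b c d : (a * d = b * c + 1)%N ->
  farey_adj (vtx s a b) (vtx s c d).
Proof.
move=> det; have [ab cd] := det_coprime det; apply/farey_adjE; rewrite /fdet.
have [n1 ->] := vtx_coprime s ab; have [n2 ->] := vtx_coprime s cd.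
have sgn : (-1) ^+ s = 1 :> int \/ (-1) ^+ s = -1 :> int by case: s {n1 n2}; auto.
case: n1 => [[b0 a1]|[b0 ->]]; case: n2 => [[d0 c1]|[d0 ->]];
  by subst; case: sgn => e; rewrite ?e /=; lia.
Qed.

Lemma vtxE h : exists s a b, coprime a b /\ h = vtx s a b.
Proof.
case: h => [q|]; last by exists false, 1%N, 0%N.
exists (numq q < 0), `|numq q|%N, `|denq q|%N; split; first exact: coprime_num_den.
have := denq_gt0 q; rewrite /vtx; case e : `|denq q|%N => [|n] d0; first by lia.
by rewrite -e -intEsign absz_denq divq_num_den.
Qed.

Lemma edge_size_bound (E : list (vertex Farey * vertex Farey)) :
  exists N, forall x y : vertex Farey, In (x, y) E -> (fsize x + fsize y < N)%N.
Proof.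
elim: E => [|[u v] E [N HN]]; first by exists 0%N.
exists (maxn N (fsize u + fsize v).+1) => x y [[<- <-]|/HN]; lia.
Qed.

Lemma farey_reconnect E s a b c d : (a * d = b * c + 1)%N ->
  clos_refl_trans _ (@adj_minus Farey E) (vtx s a b) (vtx s c d).
Proof.
have [N HN] := edge_size_bound E.
(* [k] bounds the number of mediant steps left: each one raises the total size of the ends, and an
   edge of size at least [N] is not in [E]. *)
have [k] : exists k, (N <= a + b + c + d + k)%N by exists N; lia.
elim: k a b c d => [|k IH] a b c d hk det; have [ab cd] := det_coprime det.
  apply: rt_step; split; first exact: vtx_adj.
  by split=> /HN; rewrite !vtx_size //; lia.
apply: (rt_trans _ _ _ (vtx s (a + c) (b + d))).
  by apply: IH; [nia|lia].
by apply: IH; [nia|lia].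
Qed.

Lemma adj_minus_walk_sym (G : graph) E (x y : vertex G) :
  clos_refl_trans _ (adj_minus E) x y -> clos_refl_trans _ (adj_minus E) y x.
Proof.
elim=> {x y} [x y xy|x|x y z _ yx _ zy]; last exact: rt_trans zy yx.
  by apply: rt_step; apply: adj_minus_sym.
exact: rt_refl.
Qed.

(** The Euclidean algorithm on [(i, j)]: each step replaces one vector of the basis by the mediant,
    which [farey_reconnect] joins to the old ends. *)
Lemma farey_cone E s i j a b c d : coprime i j -> (a * d = b * c + 1)%N ->
  clos_refl_trans _ (@adj_minus Farey E)
    (vtx s a b) (vtx s (i * a + j * c) (i * b + j * d)).
Proof.
have [n] := ubnP (i + j)%N; elim: n i j a b c d => // n IH i j a b c d hn ij det.
have edge := farey_reconnect E s det.
case: (posnP i) ij => [-> |i0] ij.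
  by move: ij; rewrite /coprime gcd0n => /eqP->; rewrite !mul0n !mul1n.
case: (posnP j) ij => [-> |j0] ij.
  move: ij; rewrite /coprime gcdn0 => /eqP->; rewrite !mul0n !mul1n !addn0.
  exact: rt_refl.
have [le_ij|lt_ji] := leqP i j.
  have -> : (i * a + j * c = i * (a + c) + (j - i) * c)%N by nia.
  have -> : (i * b + j * d = i * (b + d) + (j - i) * d)%N by nia.
  apply: (rt_trans _ _ _ (vtx s (a + c) (b + d))).
    by apply: farey_reconnect; lia.
  apply: IH; [lia| |lia].
  by move: ij; rewrite -{1}(subnK le_ij) /coprime gcdnDr.
have -> : (i * a + j * c = (i - j) * a + j * (a + c))%N by nia.
have -> : (i * b + j * d = (i - j) * b + j * (b + d))%N by nia.
apply: IH; [lia| |lia].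
by move: ij; rewrite coprime_sym -{1}(subnK (ltnW lt_ji)) /coprime gcdnDr gcdnC.
Qed.

Lemma farey_inf_edge_connected : inf_edge_connected Farey.
Proof.
split; first by exists None, (Some 0).
move=> E; suff from h : clos_refl_trans _ (@adj_minus Farey E) None h.
  by move=> x y; apply: rt_trans (from y); apply: adj_minus_walk_sym.
have [s [a [b [ab ->]]]] := vtxE h.
have := @farey_cone E s a b 1 0 0 1 ab erefl.
by rewrite !muln1 !muln0 addn0.
Qed.

Lemma farey_Pi_graph : Pi_graph Farey.
Proof. by split; [exact: farey_inf_edge_connected|exact: farey_no_inf_indep]. Qed.

Theorem theorem3p2 :
  tightly_typical Farey /\
  forall G : graph, tightly_typical G -> tight_minor_equiv G Farey.
Proof.
split; first by split; [exact: farey_Pi_graph|exact: farey_tight_minor].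
move=> G [PiG minG]; split; first exact: minG farey_Pi_graph.
exact: farey_tight_minor.
Qed.
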